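(* Let $N$ be a positive integer, let $k$ be a field, and let $M$ be an $N$-complex of finite dimensional $k$-vector spaces (that is, ${}_iM$ is finite dimensional for each $i\in\mathbb{Z}$). Then $$M\simeq\bigoplus_{i\in\mathbb{Z},\ 0\le l\le N-1}n_i^l\,M_i^l$$ for a unique family of (finite) non-negative integers $n_i^l$, where $n_i^lM_i^l$ denotes the direct sum of $n_i^l$ copies of $M_i^l$.
   Context: An $N$-complex is a $\mathbb{Z}$-graded $k$-vector space $\{{}_iM\}_{i\in\mathbb{Z}}$ together with linear maps $d_i:{}_iM\to{}_{i+1}M$ such that $d_{i+N-1}\circ\dots\circ d_i=0$ for each $i\in\mathbb{Z}$. Morphisms are degree-preserving linear maps commuting with the $d_i$. For $i\in\mathbb{Z}$ and $0\le l\le N-1$, $M_i^l$ is the $N$-complex with ${}_j(M_i^l)=k$ for $i\le j\le i+l$ and ${}_j(M_i^l)=0$ otherwise, where $d_i,d_{i+1},\dots,d_{i+l-1}$ are the identity and all other $d_j$ are zero. *)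

(* Defs.v *)
From HB Require Import structures.
From mathcomp Require Import all_boot all_order all_algebra.
From mathcomp Require Import boolp classical_sets functions cardinality.

Set Implicit Arguments.
Unset Strict Implicit.
Unset Printing Implicit Defensive.

Import Order.TTheory GRing.Theory Num.Theory.
Local Open Scope ring_scope.

(* An alias of forall t, V t, so that its pointwise module structure does not
   compete with the existing instance on non-dependent functions T -> V. *)
Definition dprod (R : pzRingType) (T : Type) (V : T -> lmodType R) : Type :=
  forall t, V t.
Identity Coercion fun_of_dprod : dprod >-> Funclass.

Section DirectProduct.
Variables (R : pzRingType) (T : Type) (V : T -> lmodType R).
Implicit Types f g h : dprod V.

HB.instance Definition _ := gen_eqMixin (dprod V).
HB.instance Definition _ := gen_choiceMixin (dprod V).

Definition dprod_zero : dprod V := fun=> 0.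
Definition dprod_opp f : dprod V := fun t => - f t.
Definition dprod_add f g : dprod V := fun t => f t + g t.
Definition dprod_scale (a : R) f : dprod V := fun t => a *: f t.

Fact dprod_addA : associative dprod_add.
Proof. by move=> f g h; apply: functional_extensionality_dep => t; apply: addrA. Qed.
Fact dprod_addC : commutative dprod_add.
Proof. by move=> f g; apply: functional_extensionality_dep => t; apply: addrC. Qed.
Fact dprod_add0 : left_id dprod_zero dprod_add.
Proof. by move=> f; apply: functional_extensionality_dep => t; apply: add0r. Qed.
Fact dprod_addN : left_inverse dprod_zero dprod_opp dprod_add.
Proof. by move=> f; apply: functional_extensionality_dep => t; apply: addNr. Qed.

HB.instance Definition _ := GRing.isZmodule.Build (dprod V)
  dprod_addA dprod_addC dprod_add0 dprod_addN.

Fact dprod_scaleA a b f : dprod_scale a (dprod_scale b f) = dprod_scale (a * b) f.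
Proof. by apply: functional_extensionality_dep => t; apply: scalerA. Qed.
Fact dprod_scale1 : left_id 1 dprod_scale.
Proof. by move=> f; apply: functional_extensionality_dep => t; apply: scale1r. Qed.
Fact dprod_scaleDr : right_distributive dprod_scale +%R.
Proof.
by move=> a f g; apply: functional_extensionality_dep => t; apply: scalerDr.
Qed.
Fact dprod_scaleDl f : {morph dprod_scale^~ f : a b / a + b}.
Proof.
by move=> a b; apply: functional_extensionality_dep => t; apply: scalerDl.
Qed.

HB.instance Definition _ := GRing.Zmodule_isLmodule.Build R (dprod V)
  dprod_scaleA dprod_scale1 dprod_scaleDr dprod_scaleDl.

Definition dfinsupp : pred (dprod V) :=
  fun f => `[< finite_set [set t | f t <> 0]%classic >].

Fact dfinsupp_submod_closed : submod_closed dfinsupp.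
Proof.
split.
  apply/asboolP; rewrite (_ : mkset _ = set0) //.
  by apply/seteqP; split=> // t /=; apply.
move=> a f g /asboolP fin_f /asboolP fin_g; apply/asboolP.
apply: (@sub_finite_set _ _ ([set t | f t <> 0] `|` [set t | g t <> 0])%classic);
  last by rewrite finite_setU.
move=> t /= nz; have [f0|] := pselect (f t = 0); last by left.
right=> g0; apply: nz.
by rewrite -[LHS]/(a *: f t + g t) f0 g0 scaler0 addr0.
Qed.

HB.instance Definition _ :=
  GRing.isSubmodClosed.Build R (dprod V) dfinsupp dfinsupp_submod_closed.

Record dsum : Type := DSum { dsum_val :> dprod V; _ : dsum_val \in dfinsupp }.

HB.instance Definition _ := [isSub for dsum_val].
HB.instance Definition _ := [Choice of dsum by <:].
HB.instance Definition _ := [SubChoice_isSubZmodule of dsum by <:].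
HB.instance Definition _ := [SubZmodule_isSubLmodule of dsum by <:].

End DirectProduct.

Section DirectSumMap.
Variables (R : pzRingType) (T : Type) (V W : T -> lmodType R).
Variable (u : forall t, {linear V t -> W t}).

Fact dsum_map_subproof (f : dsum V) :
  (fun t => u t (f t) : W t) \in @dfinsupp _ _ W.
Proof.
case: f => f /= /asboolP fin_f; apply/asboolP.
by apply: sub_finite_set fin_f => t /= nz f0; apply: nz; rewrite f0 linear0.
Qed.

Definition dsum_map (f : dsum V) : dsum W := DSum (dsum_map_subproof f).

Fact dsum_map_linear : linear dsum_map.
Proof.
move=> a f g; apply: val_inj; apply: functional_extensionality_dep => t.
exact: linearP.
Qed.

HB.instance Definition _ :=
  GRing.isLinear.Build R (dsum V) (dsum W) _ dsum_map dsum_map_linear.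

End DirectSumMap.

Section IteratedDifferential.
Variables (k : fieldType) (obj : int -> lmodType k).
Variable (d : forall i, {linear obj i -> obj (i + 1)}).

(* iter_diff n i is the composite of n maps d (i + n - 1) \o ... \o d i; its
   target index is i + n, written so that the recursion typechecks. *)
Fixpoint iter_diff (n : nat) (i : int) :
    obj i -> obj (iter n (fun j => j + 1) i) :=
  match n with
  | 0%N => fun x => x
  | n'.+1 => fun x => d _ (iter_diff n' x)
  end.

End IteratedDifferential.

Record ncomplex (k : fieldType) (N : nat) := NComplex {
  nc_obj :> int -> lmodType k;
  nc_diff : forall i, {linear nc_obj i -> nc_obj (i + 1)};
  nc_diff_nilp : forall i (x : nc_obj i), iter_diff nc_diff N x = 0 }.

Record nc_hom (k : fieldType) (N : nat) (M M' : ncomplex k N) := NCHom {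
  nc_map :> forall i, {linear M i -> M' i};
  nc_mapP : forall i (x : M i),
    nc_map (i + 1) (nc_diff M i x) = nc_diff M' i (nc_map i x) }.

Definition nc_iso (k : fieldType) (N : nat) (M M' : ncomplex k N) : Prop :=
  exists (f : nc_hom M M') (g : nc_hom M' M),
    forall i, cancel (f i) (g i) /\ cancel (g i) (f i).

Definition finite_dimensional (k : fieldType) (V : lmodType k) : Prop :=
  exists n : nat, inhabited (Vector.axiom n V).

Section DirectSumComplex.
Variables (k : fieldType) (N : nat) (T : Type) (X : T -> ncomplex k N).

Definition nc_dsum_diff (i : int) :
    {linear dsum (fun t => X t i) -> dsum (fun t => X t (i + 1))} :=
  dsum_map (fun t => nc_diff (X t) i).

Fact nc_dsum_iter n i (x : dsum (fun t => X t i)) t :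
  iter_diff (obj := fun i => dsum (fun t => X t i)) nc_dsum_diff n x t
  = iter_diff (nc_diff (X t)) n (x t).
Proof. by elim: n => //= n ->. Qed.

Fact nc_dsum_nilp i (x : dsum (fun t => X t i)) :
  iter_diff (obj := fun i => dsum (fun t => X t i)) nc_dsum_diff N x = 0.
Proof.
apply: val_inj; apply: functional_extensionality_dep => t.
by rewrite [LHS]nc_dsum_iter nc_diff_nilp.
Qed.

Definition nc_dsum : ncomplex k N := NComplex nc_dsum_nilp.

End DirectSumComplex.

Definition nc_copies (k : fieldType) (N n : nat) (X : ncomplex k N) :
    ncomplex k N :=
  nc_dsum (fun _ : 'I_n => X).

Section IntervalComplex.
Variables (k : fieldType) (N : nat) (i : int) (l : 'I_N).

(* The boolean is read as 0 or 1: the component in degree j is k (as row vectors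
   of length 1) for i <= j <= i + l, and 0 otherwise. *)
Definition interval_obj (j : int) : lmodType k := 'rV[k]_(i <= j <= i + l%:Z)%R.

(* pid_mx 1 is the 1 x 1 identity when both components are k; in all other
   cases one of its dimensions is 0 and the map is zero. *)
Definition interval_diff (j : int) :
    {linear interval_obj j -> interval_obj (j + 1)} :=
  mulmxr (pid_mx 1 : 'M[k]_((i <= j <= i + l%:Z)%R, (i <= j + 1 <= i + l%:Z)%R)).

Fact interval_obj0 j (x : interval_obj j) : ~~ (i <= j <= i + l%:Z) -> x = 0.
Proof.
rewrite /interval_obj in x *; case: (i <= j <= _) x => // x _.
exact: thinmx0.
Qed.

Fact iter_addr1 n (j : int) : iter n (fun j => j + 1) j = j + n%:Z.
Proof. by elim: n => [|n /= ->]; rewrite ?addr0 // -addrA -addn1 PoszD. Qed.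

Fact interval_nilp j (x : interval_obj j) : iter_diff interval_diff N x = 0.
Proof.
have [/andP[le_ij _]|out] := boolP (i <= j <= i + l%:Z).
  apply: interval_obj0; rewrite iter_addr1 negb_and -!ltNge; apply/orP; right.
  by apply: ler_ltD; rewrite // ltz_nat.
rewrite (interval_obj0 x out); elim: (N) => // n IHn.
by rewrite -[LHS]/(interval_diff _ (iter_diff _ n 0)) IHn linear0.
Qed.

Definition interval_complex : ncomplex k N := NComplex interval_nilp.

End IntervalComplex.

(* Main.v *)
(* Let v_(i,l) be vectors of M_i forming a basis of ker d^(l+1) modulo
   ker d^l + im d.  For each j, the vectors d^m v with v in v_(j-m,l) and m <= l
   form a basis of M_j: they span because z in ker d^(l+1) is a combination of
   v_(i,l) plus an element of ker d^l plus some d w with w in ker d^(l+2), and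
   this can be iterated on both remainders until d^N = 0 applies; they are free because, in a relation, applying the
   power of d that keeps only the terms with the largest l - m leaves as the term
   of smallest m an element of ker d^l + im d.  This basis is an isomorphism from
   a direct sum of interval complexes.  The number of vectors in v_(i,l) is an
   isomorphism invariant, equal to n_i^l for the direct sum, whence uniqueness. *)
Require Import Defs.
From HB Require Import structures.
From mathcomp Require Import all_boot all_order all_algebra.
From mathcomp Require Import boolp classical_sets functions cardinality.
From mathcomp Require Import zify.

Set Implicit Arguments.
Unset Strict Implicit.
Unset Printing Implicit Defensive.

Import Order.TTheory GRing.Theory Num.Theory.
Local Open Scope ring_scope.

(** * Bases of one subspace modulo another *)

Section RelativeBasis.
Variables (k : fieldType) (V : lmodType k) (P Q : V -> Prop).
Hypothesis Q0 : Q 0.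
Hypothesis QD : forall x y, Q x -> Q y -> Q (x + y).
Hypothesis QZ : forall a x, Q x -> Q (a *: x).

(** Independence is taken in the quotient V/Q, so for subspaces [basis_mod] describes a basis of the
    image of [P] in V/Q. *)
Definition free_mod m (v : 'I_m -> V) : Prop :=
  (forall t, P (v t)) /\ forall c, Q (\sum_t c t *: v t) -> forall t, c t = 0.

Definition basis_mod m (v : 'I_m -> V) : Prop :=
  free_mod v /\ forall x, P x -> exists c, Q (x - \sum_t c t *: v t).

Lemma Q_sum m (v : 'I_m -> V) : (forall t, Q (v t)) -> Q (\sum_t v t).
Proof. by move=> Qv; elim/big_ind: _. Qed.

(** If m < m', the matrix expressing [v'] through [v] modulo [Q] has a nonzero vector in its left
    kernel, which is a nontrivial relation for [v'] modulo [Q]. *)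
Lemma basis_mod_le m m' (v : 'I_m -> V) (v' : 'I_m' -> V) :
  basis_mod v -> free_mod v' -> (m' <= m)%N.
Proof.
move=> [[Pv _] span_v] [Pv' free_v'].
have /choice[A A_P] t := span_v _ (Pv' t).
pose B : 'M[k]_(m', m) := \matrix_(t, s) A t s.
rewrite leqNgt; apply/negP => lt_mm'.
have /rowV0Pn[u /sub_kermxP uB0 /rV0Pn[s us]] : kermx B != 0.
  rewrite kermx_eq0 /row_free neq_ltn; apply/orP; left.
  exact: leq_ltn_trans (rank_leq_col _) lt_mm'.
case/eqP: us; apply: (free_v' (fun t => u 0 t)).
have -> : \sum_t u 0 t *: v' t = \sum_t u 0 t *: (v' t - \sum_s A t s *: v s).
  under [RHS]eq_bigr do rewrite scalerBr scaler_sumr.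
  rewrite sumrB exchange_big /= [X in _ - X]big1 ?subr0 // => r _.
  under eq_bigr do rewrite scalerA.
  rewrite -scaler_suml (_ : \sum_t _ = 0) ?scale0r //.
  have /rowP/(_ r) := uB0; rewrite !mxE => {2}<-.
  by apply: eq_bigr => t _; rewrite mxE.
by apply: Q_sum => t; apply: QZ.
Qed.

Lemma basis_mod_size m m' (v : 'I_m -> V) (v' : 'I_m' -> V) :
  basis_mod v -> basis_mod v' -> m = m'.
Proof.
move=> bv bv'; apply/eqP; rewrite eqn_leq.
by rewrite (basis_mod_le bv' bv.1) (basis_mod_le bv bv'.1).
Qed.

(** The same kernel argument with coordinates in k^n: a relation in [V] is one modulo [Q], as [Q]
    contains 0. *)
Lemma free_mod_dim m (v : 'I_m -> V) n : Vector.axiom n V -> free_mod v -> (m <= n)%N.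
Proof.
move=> [r2v r2v_lin r2v_bij] [_ free_v].
pose h := GRing.isLinear.Build _ _ _ _ r2v r2v_lin.
pose f : {linear V -> 'rV[k]_n} := HB.pack r2v h.
rewrite leqNgt; apply/negP => lt_nm.
pose B : 'M[k]_(m, n) := \matrix_t f (v t).
have /rowV0Pn[u /sub_kermxP uB0 /rV0Pn[s us]] : kermx B != 0.
  rewrite kermx_eq0 /row_free neq_ltn; apply/orP; left.
  exact: leq_ltn_trans (rank_leq_col _) lt_nm.
case/eqP: us; apply: (free_v (fun t => u 0 t)).
suff -> : \sum_t u 0 t *: v t = 0 by [].
apply: (bij_inj r2v_bij); rewrite -[LHS]/(f _) -[RHS]/(f 0) linear0 linear_sum.
rewrite -[RHS]uB0 mulmx_sum_row; apply: eq_bigr => t _.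
by rewrite linearZ rowK.
Qed.

(** A relation with a nonzero coefficient at [x] could be solved for [x] modulo [Q]. So that
    coefficient is 0, and what remains is a relation for [v]. *)
Lemma free_mod_extend m (v : 'I_m -> V) x :
    free_mod v -> P x -> ~ (exists c, Q (x - \sum_t c t *: v t)) ->
  free_mod (fun t : 'I_m.+1 => if unlift ord0 t is Some s then v s else x).
Proof.
move=> [Pv free_v] Px nspan; split=> [t | c]; first by case: unliftP.
rewrite big_ord_recl unlift_none; under eq_bigr do rewrite liftK.
move=> Qc; have c0 : c ord0 = 0.
  apply: contrapT => /eqP nz; apply: nspan.
  exists (fun t => - (c ord0)^-1 * c (lift ord0 t)).
  have -> : \sum_t (- (c ord0)^-1 * c (lift ord0 t)) *: v t
    = - ((c ord0)^-1 *: \sum_t c (lift ord0 t) *: v t).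
    by rewrite scaler_sumr -sumrN; apply: eq_bigr => t _; rewrite -scalerA scaleNr.
  rewrite opprK.
  by have := QZ (c ord0)^-1 Qc; rewrite scalerDr scalerA mulVf // scale1r.
move=> t; case: (unliftP ord0 t) => [s ->|-> //].
apply: (free_v (fun s => c (lift ord0 s))).
by rewrite c0 scale0r add0r in Qc.
Qed.

(** A free family of maximal size spans, since otherwise it could be extended; the dimension bounds
    the sizes. *)
Lemma basis_mod_exists : finite_dimensional V ->
  exists m (v : 'I_m -> V), basis_mod v.
Proof.
move=> [n [Vn]].
pose A m := `[< exists v : 'I_m -> V, free_mod v >].
have exA : exists m, A m.
  exists 0%N; apply/asboolP; exists (fun=> 0).
  by split=> [[]|c _ []].
have leA m : A m -> (m <= n)%N.
  by move=> /asboolP[v /(free_mod_dim Vn)].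
have [m /asboolP[v free_v] max_m] := ex_maxnP exA leA.
exists m, v; split=> // x Px; apply: contrapT => nspan.
have /max_m : A m.+1 by apply/asboolP; eexists; apply: free_mod_extend nspan.
by rewrite ltnn.
Qed.

End RelativeBasis.

(** * Powers of the differential, their kernels, and generators *)

Section DifferentialPower.
Variables (k : fieldType) (N : nat) (M : ncomplex k N).
Local Notation up m i := (iter m (fun j : int => j + 1) i).

(* The map M_i -> M_j is d^(j - i) if i <= j, and 0 otherwise. *)
Definition dpow (i j : int) (x : M i) : M j :=
  match up `|j - i|%N i =P j with
  | ReflectT e => ecast j (M j) e (iter_diff (nc_diff M) `|j - i|%N x)
  | ReflectF _ => 0
  end.

(** This removes the cast: once a target j >= i is written as [up m i] by [le_up], facts about
    [dpow] follow by induction on [m]. *)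
Lemma dpow_iter m i (x : M i) : dpow (up m i) x = iter_diff (nc_diff M) m x.
Proof.
have Em : `|up m i - i|%N = m by rewrite iter_addr1; lia.
rewrite /dpow; case: eqP; rewrite Em // => e.
by rewrite eq_axiomK.
Qed.

Lemma le_up (i j : int) : i <= j -> exists m, j = up m i.
Proof. by move=> le_ij; exists `|j - i|%N; rewrite iter_addr1; lia. Qed.

Lemma dpow_gt i j (x : M i) : j < i -> dpow j x = 0.
Proof.
rewrite /dpow => lt_ji; case: eqP => // e; exfalso.
by move: e; rewrite iter_addr1; lia.
Qed.

Lemma dpow_linear i j : linear (@dpow i j).
Proof.
move=> a x y; have [lt_ji|/le_up[m ->]] := ltP j i.
  by rewrite !dpow_gt // scaler0 addr0.
rewrite !dpow_iter; elim: m => //= m ->; exact: linearP.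
Qed.

HB.instance Definition _ i j :=
  GRing.isLinear.Build k (M i) (M j) _ (@dpow i j) (@dpow_linear i j).

Lemma dpow_id i (x : M i) : dpow i x = x.
Proof. exact: (dpow_iter 0). Qed.

Lemma dpow_succ i j (x : M i) : i <= j -> dpow (j + 1) x = nc_diff M j (dpow j x).
Proof. by move=> /le_up[m ->]; rewrite (dpow_iter m.+1) dpow_iter. Qed.

Lemma dpow_comp i j l (x : M i) : i <= j -> j <= l -> dpow l (dpow j x) = dpow l x.
Proof.
move=> le_ij /le_up[m ->]; elim: m => [|m IHm] /=; first exact: dpow_id.
by rewrite !dpow_succ ?IHm // iter_addr1; lia.
Qed.

Lemma dpow_nilp i j (x : M i) : i + N%:Z <= j -> dpow j x = 0.
Proof.
move=> le_j; rewrite -(@dpow_comp i (i + N%:Z)) //; last by lia.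
by rewrite -iter_addr1 dpow_iter nc_diff_nilp linear0.
Qed.

Lemma dpow_ker i j l (x : M i) : dpow j x = 0 -> i <= j -> j <= l -> dpow l x = 0.
Proof. by move=> x0 le_ij le_jl; rewrite -(dpow_comp x le_ij le_jl) x0 linear0. Qed.

Definition dker (i : int) (l : nat) (x : M i) : Prop := dpow (i + l%:Z) x = 0.

(** The subspace ker d^l + im d. On [M (i - 1)], [dpow i] is the differential with target [M i]
    instead of [M (i - 1 + 1)]. *)
Definition dker_im (i : int) (l : nat) (x : M i) : Prop :=
  exists w : M (i - 1), dker l (x - dpow i w).

Definition generators (i : int) (l m : nat) (v : 'I_m -> M i) : Prop :=
  basis_mod (@dker i l.+1) (@dker_im i l) v.

Lemma dker_comb i l m (v : 'I_m -> M i) c :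
  (forall t, dker l (v t)) -> dker l (\sum_t c t *: v t).
Proof.
move=> kv; rewrite /dker linear_sum big1 // => t _.
by rewrite linearZ /= kv scaler0.
Qed.

Lemma dker_im0 i l : @dker_im i l 0.
Proof. by exists 0; rewrite /dker [dpow i 0]linear0 subr0 linear0. Qed.

Lemma dker_imD i l x y : @dker_im i l x -> @dker_im i l y -> @dker_im i l (x + y).
Proof.
move=> [w kx] [w' ky]; exists (w + w').
rewrite /dker (_ : x + y - _ = (x - dpow i w) + (y - dpow i w')).
  by rewrite linearD /= kx ky addr0.
by rewrite linearD opprD addrACA.
Qed.

Lemma dker_imZ i l a x : @dker_im i l x -> @dker_im i l (a *: x).
Proof.
by move=> [w kx]; exists (a *: w); rewrite /dker linearZ /= -scalerBr linearZ /= kx scaler0.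
Qed.

Lemma generators_size i l m m' (v : 'I_m -> M i) (v' : 'I_m' -> M i) :
  generators l v -> generators l v' -> m = m'.
Proof.
apply: basis_mod_size;
  [exact: dker_im0 | exact: dker_imD | exact: dker_imZ].
Qed.

Lemma generators_exist i l : finite_dimensional (M i) ->
  exists m (v : 'I_m -> M i), generators l v.
Proof.
by apply: basis_mod_exists; [exact: dker_im0 | exact: dker_imZ].
Qed.

End DifferentialPower.

(** * The scalar coordinate on an interval complex *)

Section IntervalCoordinate.
Variables (k : fieldType) (N : nat) (i : int) (l : 'I_N).

Definition interval_of (j : int) (a : k) : interval_obj k i l j :=
  (const_mx a : 'rV[k]_(i <= j <= i + l%:Z)%R).

(** The sum is the only entry inside the interval and the empty sum outside, which gives one formula
    for both dimensions. *)
Definition interval_coord (j : int) (x : interval_obj k i l j) : k :=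
  \sum_q (x : 'rV[k]_(i <= j <= i + l%:Z)%R) 0 q.

Lemma interval_coord_linear j : scalar (@interval_coord j).
Proof.
move=> a x y; rewrite /interval_coord mulr_sumr -big_split /=.
by apply: eq_bigr => q _; rewrite !mxE.
Qed.

HB.instance Definition _ j := GRing.isLinear.Build k (interval_obj k i l j) k _
  (@interval_coord j) (@interval_coord_linear j).

Lemma interval_coordK j (x : interval_obj k i l j) :
  interval_of j (interval_coord x) = x.
Proof.
rewrite /interval_of /interval_coord; move: x; rewrite /interval_obj.
case: (i <= j <= _) => x; apply/rowP=> q; last by case: q.
by rewrite mxE (big_pred1 q) // => s; rewrite (ord1 s) (ord1 q).
Qed.

Lemma interval_ofK j a :
  interval_coord (interval_of j a) = if (i <= j <= i + l%:Z) then a else 0.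
Proof.
rewrite /interval_of /interval_coord; case: (i <= j <= _).
  by rewrite big_ord1 mxE.
by rewrite big_ord0.
Qed.

Lemma interval_coord_out j (x : interval_obj k i l j) :
  ~~ (i <= j <= i + l%:Z) -> interval_coord x = 0.
Proof. by move=> out; rewrite [x]interval_obj0 // linear0. Qed.

Lemma interval_coord_diff j (x : interval_obj k i l j) :
  interval_coord (interval_diff k i l j x)
  = if (i <= j + 1 <= i + l%:Z) then interval_coord x else 0.
Proof.
have [out|] := boolP (i <= j + 1 <= i + l%:Z); last exact: interval_coord_out.
have [inn|/[dup] out' /interval_coord_out ->] := boolP (i <= j <= i + l%:Z);
  last first.
  by rewrite [x]interval_obj0 // !linear0.
rewrite /interval_coord /interval_diff /=; move: x; rewrite /interval_obj inn out => x.
by rewrite !big_ord1 pid_mx_1 mulmx1.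
Qed.

End IntervalCoordinate.

(** * Coordinates on a direct sum of interval complexes *)

Section StandardComplex.
Variables (k : fieldType) (N : nat) (n : int -> 'I_N -> nat).

Definition std : ncomplex k N := nc_dsum (fun p : int * 'I_N =>
  nc_copies (n p.1 p.2) (interval_complex k p.1 p.2)).

Let coeffs := forall p : int * 'I_N, 'I_(n p.1 p.2) -> k.

Definition std_coord (j : int) (p : int * 'I_N) (t : 'I_(n p.1 p.2)) (x : std j) : k :=
  interval_coord ((x : dsum (fun p : int * 'I_N =>
    dsum (fun _ : 'I_(n p.1 p.2) => interval_obj k p.1 p.2 j))) p t).

Lemma std_of_inner_subproof j (c : coeffs) (p : int * 'I_N) :
  (fun t => interval_of p.1 p.2 j (c p t)) \in
    dfinsupp (V := fun _ : 'I_(n p.1 p.2) => interval_obj k p.1 p.2 j).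
Proof. by apply/asboolP; exact: finite_finset. Qed.

(** An interval containing [j] starts at j - m with m < N and has l < N, so at most N * N pairs (i,
    l) contribute and arbitrary coefficients give finite support. *)
Lemma std_of_subproof j (c : coeffs) :
  (fun p => DSum (std_of_inner_subproof j c p)) \in
    dfinsupp (V := fun p : int * 'I_N =>
      dsum (fun _ : 'I_(n p.1 p.2) => interval_obj k p.1 p.2 j)).
Proof.
apply/asboolP.
pose g (q : 'I_N * 'I_N) : int * 'I_N := (j - (q.1 : nat)%:Z, q.2).
apply: (@sub_finite_set _ _ (g @` setT)%classic); last first.
  by apply: finite_image; exact: finite_finset.
move=> [i l] /= nz; have [/andP[le_ij le_j]|out] := boolP (i <= j <= i + l%:Z).
  have lt_N : (`|j - i|%N < N)%N by have := ltn_ord l; lia.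
  by exists (Ordinal lt_N, l) => //; rewrite /g /=; congr (_, _); lia.
case: nz; apply: val_inj; apply: functional_extensionality_dep => t.
exact: interval_obj0.
Qed.

Definition std_of (j : int) (c : coeffs) : std j := DSum (std_of_subproof j c).

Lemma std_ofK j c (p : int * 'I_N) (t : 'I_(n p.1 p.2)) : std_coord t (std_of j c)
  = if (p.1 <= j <= p.1 + (p.2 : nat)%:Z) then c p t else 0.
Proof. exact: interval_ofK. Qed.

Lemma std_coord_inj j (x y : std j) :
  (forall (p : int * 'I_N) (t : 'I_(n p.1 p.2)), std_coord t x = std_coord t y) -> x = y.
Proof.
move=> eq_xy; apply: val_inj; apply: functional_extensionality_dep => p.
apply: val_inj; apply: functional_extensionality_dep => t.
rewrite -[LHS]interval_coordK -[RHS]interval_coordK; congr (interval_of _ _ _ _).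
exact: eq_xy.
Qed.

Lemma std_coord_linear j (p : int * 'I_N) (t : 'I_(n p.1 p.2)) :
  scalar (@std_coord j p t).
Proof. by move=> a x y; rewrite /std_coord -linearP. Qed.

HB.instance Definition _ j (p : int * 'I_N) (t : 'I_(n p.1 p.2)) :=
  GRing.isLinear.Build k (std j) k _ (@std_coord j p t) (@std_coord_linear j p t).

Lemma std_coord_out j (x : std j) (p : int * 'I_N) (t : 'I_(n p.1 p.2)) :
  ~~ (p.1 <= j <= p.1 + (p.2 : nat)%:Z) -> std_coord t x = 0.
Proof. exact: interval_coord_out. Qed.

Lemma std_coord_diff j (x : std j) (p : int * 'I_N) (t : 'I_(n p.1 p.2)) :
  std_coord t (nc_diff std j x)
  = if (p.1 <= j + 1 <= p.1 + (p.2 : nat)%:Z) then std_coord t x else 0.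
Proof. exact: interval_coord_diff. Qed.

End StandardComplex.

(** * Generators of the direct sum of interval complexes *)

Section StandardGenerators.
Variables (k : fieldType) (N : nat) (n : int -> 'I_N -> nat).

Lemma std_coord_comb j m (v : 'I_m -> std k n j) c (p : int * 'I_N)
    (t : 'I_(n p.1 p.2)) :
  std_coord t (\sum_s c s *: v s) = \sum_s c s * std_coord t (v s).
Proof.
by rewrite linear_sum; apply: eq_bigr => s _; rewrite linearZ.
Qed.

(** Only the right end is tested: on an interval starting after [i], the coordinate of [x] is
    already 0. *)
Lemma std_coord_dpow i j (x : std k n i) (p : int * 'I_N) (t : 'I_(n p.1 p.2)) :
  i <= j ->
  std_coord t (dpow j x) = if j <= p.1 + (p.2 : nat)%:Z then std_coord t x else 0.
Proof.
move=> le_ij; have [m Ej] := le_up le_ij; move: Ej le_ij => ->.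
elim: m => [|m IHm] /= le_ij.
  rewrite dpow_id; case: ifPn => // out.
  by apply: std_coord_out; rewrite negb_and out orbT.
move: IHm; rewrite !iter_addr1 => IHm; rewrite dpow_succ; last by lia.
rewrite std_coord_diff IHm; last by lia.
case: ifPn => [/andP[_ le_p]|].
  by rewrite le_p ifT //; lia.
rewrite negb_and; case: ifP => [le_p|//]; rewrite orbF => lt_p.
by rewrite std_coord_out //; lia.
Qed.

(** The left end of the [t]-th copy of M_i^l. The indices [s] and [t] have different types, hence
    the comparison in [nat]. *)
Definition std_gen (i : int) (l : 'I_N) (t : 'I_(n i l)) : std k n i :=
  std_of i (fun p s => ((p == (i, l)) && ((s : nat) == t))%:R).

Lemma std_gen_coord i l (t : 'I_(n i l)) (p : int * 'I_N) (s : 'I_(n p.1 p.2)) :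
  std_coord s (std_gen t) = ((p == (i, l)) && ((s : nat) == t))%:R.
Proof.
rewrite std_ofK; case: eqP => [ep|_] /=; last by rewrite if_same.
by rewrite ifT // ep lexx ler_wpDr.
Qed.

Lemma std_gen_comb_coord i l (c : 'I_(n i l) -> k) (t : 'I_(n i l)) :
  std_coord (p := (i, l)) t (\sum_s c s *: std_gen s) = c t.
Proof.
rewrite std_coord_comb (bigD1 t) //= std_gen_coord !eqxx mulr1.
rewrite big1 ?addr0 // => s ne_st.
by rewrite std_gen_coord eqxx /= eq_sym (negbTE ne_st : (s == t :> nat) = _) mulr0.
Qed.

Lemma std_gen_comb_coord_out i l (c : 'I_(n i l) -> k) (p : int * 'I_N)
    (s : 'I_(n p.1 p.2)) :
  p != (i, l) -> std_coord s (\sum_s c s *: std_gen s) = 0.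
Proof.
move=> ne_p; rewrite std_coord_comb big1 // => t _.
by rewrite std_gen_coord (negbTE ne_p) mulr0.
Qed.

(** In degree i, ker d^(l+1) comes from the intervals ending at or before i + l, ker d^l from those
    ending before i + l, and im d from those starting before i. Exactly the copies of M_i^l survive
    in the quotient. *)
Lemma std_generators i (l : 'I_N) : generators l (fun t : 'I_(n i l) => std_gen t).
Proof.
split; first split.
- move=> t; apply: std_coord_inj => p s; rewrite linear0 std_coord_dpow; last by lia.
  rewrite std_gen_coord; case: eqP => [ep|_] /=; last by rewrite if_same.
  by rewrite ifF // ep /=; lia.
- move=> c [w kw] t.
  have := congr1 (fun x => std_coord (p := (i, l)) t x) kw.
  rewrite /= linear0 std_coord_dpow ?lexx; last by lia.
  rewrite linearB /=.
  rewrite std_gen_comb_coord std_coord_dpow; last by lia.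
  by rewrite ler_wpDr //= std_coord_out ?subr0 //=; lia.
- move=> x kx; exists (fun t => std_coord (p := (i, l)) t x).
  (* The coordinates of [x] are copied one degree down, where intervals starting at [i] drop out;
     the differential then returns the part of [x] on the earlier ones. *)
  exists (std_of (i - 1) (fun p t => std_coord t x)).
  apply: std_coord_inj => p t; rewrite linear0 std_coord_dpow; last by lia.
  case: ifP => // le_p; rewrite !linearB /= std_coord_dpow; last by lia.
  rewrite std_ofK.
  have [/andP[le_pi _]|out] := boolP (p.1 <= i <= p.1 + (p.2 : nat)%:Z); last first.
    rewrite !(std_coord_out _ _ out) !if_same !subr0 //.
  have := congr1 (fun x => std_coord t (p := p) x) kx.
  rewrite /= linear0 std_coord_dpow; last by lia.
  (* Intervals reaching i + l + 1 have coordinate 0 by [kx]; the others end exactly at i + l, so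
     they are (i, l) or start before [i]. *)
  case: ifPn => [lt_l x0|ge_l _].
    rewrite std_gen_comb_coord_out ?x0 ?if_same ?subrr //.
    by apply: contraTneq lt_l => -> /=; lia.
  rewrite ifT; last by lia.
  have [ep|ne_p] := eqVneq p (i, l).
    subst p.
    by rewrite std_gen_comb_coord ifF ?subr0 ?subrr //=; lia.
  rewrite std_gen_comb_coord_out // subr0 ifT ?subrr //.
  have : p.1 != i; last by lia.
  apply: contraNneq ne_p => e1; rewrite [p]surjective_pairing e1.
  by apply/eqP; congr (_, _); apply: val_inj => /=; lia.
Qed.

End StandardGenerators.

(** * Isomorphisms and invariance of the number of generators *)

Section Morphisms.
Variables (k : fieldType) (N : nat).
Implicit Types M : ncomplex k N.

Lemma nc_map_dpow M M' (f : nc_hom M M') i j (x : M i) :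
  f j (dpow j x) = dpow j (f i x).
Proof.
have [lt_ji|/le_up[m ->]] := ltP j i; first by rewrite !dpow_gt // linear0.
by rewrite !dpow_iter; elim: m => //= m <-; rewrite nc_mapP.
Qed.

(** Morphisms commute with powers of d, so the inverse isomorphism carries kernels and images to
    kernels and images. *)
Lemma generators_iso M M' i l m (v : 'I_m -> M' i) :
  nc_iso M M' -> generators l v -> exists u : 'I_m -> M i, generators l u.
Proof.
move=> [f [g fgK]] [[kv free_v] span_v]; exists (fun t => g i (v t)).
have [fK gK] := fgK i.
split; first split.
- by move=> t; rewrite /dker -nc_map_dpow kv linear0.
- move=> c [w kw]; apply: free_v; exists (f (i - 1) w).
  have Ev : f i (\sum_t c t *: g i (v t)) = \sum_t c t *: v t.
    by rewrite linear_sum; apply: eq_bigr => t _; rewrite linearZ /= gK.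
  by rewrite /dker -Ev -nc_map_dpow -linearB -nc_map_dpow kw linear0.
- move=> x kx; have [|c [w kw]] := span_v (f i x).
    by rewrite /dker -nc_map_dpow kx linear0.
  exists c; exists (g (i - 1) w).
  have Ev : g i (\sum_t c t *: v t) = \sum_t c t *: g i (v t).
    by rewrite linear_sum; apply: eq_bigr => t _; rewrite linearZ.
  by rewrite /dker -Ev -[x]fK -nc_map_dpow -!linearB -nc_map_dpow kw linear0.
Qed.

Lemma nc_iso_bij M M' (f : nc_hom M M') :
    (forall i x, f i x = 0 -> x = 0) -> (forall i y, exists x, f i x = y) ->
  nc_iso M M'.
Proof.
move=> f_inj0 f_surj.
have f_inj i : injective (f i).
  move=> x y eq_f; apply/eqP; rewrite -subr_eq0; apply/eqP/f_inj0.
  by rewrite linearB /= eq_f subrr.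
pose g i y := sval (cid (f_surj i y)).
have gK i : cancel (g i) (f i) by move=> y; exact: svalP (cid (f_surj i y)).
have g_lin i : linear (g i).
  by move=> a x y; apply: f_inj; rewrite linearP !gK.
pose gL i : {linear M' i -> M i} := HB.pack (g i)
  (GRing.isLinear.Build _ _ _ _ (g i) (g_lin i)).
have gP i (y : M' i) : gL (i + 1) (nc_diff M' i y) = nc_diff M i (gL i y).
  by apply: f_inj; rewrite nc_mapP /= !gK.
exists f, (NCHom gP) => i; split; last exact: gK.
by move=> x; apply: f_inj; exact: gK.
Qed.

Lemma nc_iso_sym M M' : nc_iso M M' -> nc_iso M' M.
Proof. by move=> [f [g fgK]]; exists g, f => i; have [] := fgK i. Qed.

(** This yields uniqueness: the generators of the direct sum are transported to [M], where any two
    families of generators have the same size. *)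
Lemma nc_iso_std_size M (n : int -> 'I_N -> nat) i (l : 'I_N) m (v : 'I_m -> M i) :
  generators l v -> nc_iso M (std k n) -> m = n i l.
Proof.
move=> gen_v iso_M.
have [u gen_u] := generators_iso iso_M (std_generators k n i l).
exact: generators_size gen_v gen_u.
Qed.

End Morphisms.

(** For compatibility with d: passing from degree j to j + 1 raises the distance m to the start of
    an interval by one. *)
Lemma sum_ord_shift (V : nmodType) (N : nat) (F G : nat -> V) :
    F 0%N = 0 -> (forall m, (m.+1 < N)%N -> F m.+1 = G m) ->
    (forall m, m.+1 = N -> G m = 0) ->
  \sum_(m < N) F m = \sum_(m < N) G m.
Proof.
case: N => [|N] F0 FG G0; first by rewrite !big_ord0.
rewrite big_ord_recl big_ord_recr /= F0 (G0 N) // add0r addr0.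
by apply: eq_bigr => m _; apply: FG; rewrite ltnS ltn_ord.
Qed.

(** * The isomorphism from the direct sum onto [M] *)

Section Decomposition.
Variables (k : fieldType) (N : nat) (M : ncomplex k N) (n : int -> 'I_N -> nat).
Variable v : forall i l, 'I_(n i l) -> M i.
Hypothesis gen_v : forall i (l : 'I_N), generators l (@v i l).

Definition comb i (l : 'I_N) (a : 'I_(n i l) -> k) : M i := \sum_t a t *: v t.

Lemma comb0 i (l : 'I_N) (a : 'I_(n i l) -> k) : (forall t, a t = 0) -> comb a = 0.
Proof. by move=> a0; apply: big1 => t _; rewrite a0 scale0r. Qed.

Lemma dpow_comb_out i j (l : 'I_N) (a : 'I_(n i l) -> k) :
  i + (l : nat)%:Z < j -> dpow j (comb a) = 0.
Proof.
move=> lt_j; have kv : dker l.+1 (comb a).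
  by apply: dker_comb; case: (gen_v i l) => [[]].
by apply: dpow_ker kv _ _; lia.
Qed.

(** The part of [x] on the copies of M_i^l, sent to [M] by the map taking the [t]-th generator to
    [v t]. *)
Definition strand j i (l : 'I_N) (x : std k n j) : M j :=
  dpow j (comb (i := i) (l := l) (fun t => std_coord (p := (i, l)) t x)).

(** Only intervals starting at j - m with m < N can contain [j], so this finite sum sees every
    coordinate. *)
Definition assemble j (x : std k n j) : M j :=
  \sum_(m < N) \sum_(l < N) strand (j - (m : nat)%:Z) l x.

Lemma strand_linear j i (l : 'I_N) : linear (@strand j i l).
Proof.
move=> a x y; rewrite /strand -linearP; congr (dpow j _).
rewrite /comb scaler_sumr -big_split /=; apply: eq_bigr => t _.
by rewrite linearP scalerDl scalerA.
Qed.

Lemma assemble_linear j : linear (@assemble j).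
Proof.
move=> a x y; rewrite /assemble scaler_sumr -big_split /=; apply: eq_bigr => m _.
rewrite scaler_sumr -big_split /=; apply: eq_bigr => l _.
exact: strand_linear.
Qed.

HB.instance Definition _ j :=
  GRing.isLinear.Build k (std k n j) (M j) _ (@assemble j) (@assemble_linear j).

Lemma strand_diff j i (l : 'I_N) (x : std k n j) : i <= j ->
  strand i l (nc_diff (std k n) j x) = nc_diff M j (strand i l x).
Proof.
move=> le_ij; rewrite /strand -dpow_succ //.
(* Past the right end i + l both sides vanish, as d^(l+1) kills the generators; before it, d
   preserves coordinates. *)
have [le_j|lt_j] := leP (j + 1) (i + (l : nat)%:Z); last first.
  by rewrite !dpow_comb_out.
congr (dpow _ _); apply: eq_bigr => t _; rewrite std_coord_diff ifT //=; lia.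
Qed.

Lemma assemble_diff j (x : std k n j) :
  assemble (nc_diff (std k n) j x) = nc_diff M j (assemble x).
Proof.
rewrite /assemble linear_sum.
under [RHS]eq_bigr do rewrite linear_sum.
pose F (m : nat) := \sum_(l < N) strand (j + 1 - m%:Z) l (nc_diff (std k n) j x).
pose G (m : nat) := \sum_(l < N) nc_diff M j (strand (j - m%:Z) l x).
apply: (@sum_ord_shift _ _ F G) => [|m lt_m|m Em]; rewrite /F /G.
(* An interval starting at j + 1 receives nothing from degree [j]. *)
- rewrite big1 // => l _; rewrite /strand comb0 ?linear0 // => t.
  by rewrite std_coord_diff /= (std_coord_out x) ?if_same //= subr0; lia.
- apply: eq_bigr => l _; rewrite -strand_diff; last by lia.
  by congr (strand _ _ _); lia.
(* Here the start is j + 1 - N, and l < N puts j + 1 past the right end. *)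
- rewrite big1 // => l _; rewrite /strand -dpow_succ; last by lia.
  by apply: dpow_comb_out; have := ltn_ord l; lia.
Qed.

Definition assemble_hom : nc_hom (std k n) M := NCHom assemble_diff.

Lemma assemble_gen i (l : 'I_N) (t : 'I_(n i l)) : assemble (std_gen k t) = v t.
Proof.
have zN : (0 < N)%N by apply: leq_ltn_trans (ltn_ord l).
have strand0 i' l' : (i', l') != (i, l) -> strand i' l' (std_gen k t) = 0.
  move=> ne; rewrite /strand comb0 ?linear0 // => s.
  by rewrite std_gen_coord (negbTE ne).
rewrite /assemble (bigD1 (Ordinal zN)) //= [X in _ + X]big1 ?addr0 => [|m ne_m].
  rewrite (bigD1 l) //= [X in _ + X]big1 ?addr0 => [|l' ne_l]; last first.
    by apply: strand0; apply: contra ne_l => /eqP[->].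
  rewrite /strand dpow_id /comb (bigD1 t) //= std_gen_coord !eqxx scale1r.
  rewrite big1 ?addr0 // => s ne_s.
  by rewrite std_gen_coord (negbTE ne_s : (s == t :> nat) = _) andbF scale0r.
apply: big1 => l' _; apply: strand0; apply: contra ne_m => /eqP[Em _].
by apply/eqP/val_inj => /=; lia.
Qed.

Lemma assemble_dpow_comb i j (l : 'I_N) (a : 'I_(n i l) -> k) :
  exists x, assemble x = dpow j (comb a).
Proof.
exists (dpow j (\sum_t a t *: std_gen k t)).
rewrite (nc_map_dpow assemble_hom) /=; congr (dpow j _).
by rewrite linear_sum; apply: eq_bigr => t _; rewrite linearZ /= assemble_gen.
Qed.

(* The measure [2 c + 3 (N - b)] decreases both when [c] drops by one and when
   [b] and [c] grow by one together. *)
Lemma assemble_dpow_ker c b i j (z : M i) :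
  (c <= N)%N -> j = i + b%:Z -> dker c z -> exists x, assemble x = dpow j z.
Proof.
have [r] := ubnP (2 * c + 3 * (N - b))%N.
elim: r c b i z => // r IHr c b i z lt_r le_c Ej kz.
have [lt_bN|le_Nb] := ltnP b N; last first.
  by exists 0; rewrite linear0 dpow_nilp //; lia.
case: c => [|l] in lt_r le_c kz *.
  exists 0; rewrite linear0; move: kz; rewrite /dker addr0 dpow_id => ->.
  by rewrite linear0.
have [a [w kw]] := (gen_v i (Ordinal le_c)).2 z kz.
have [x1 Ex1] := assemble_dpow_comb j a.
have [||x2 Ex2] := IHr l b i (z - comb a - dpow i w) _ _ Ej kw; [lia..|].
(* As d^(l+1) kills [z], [comb a] and the remainder, it kills d w, so d^(l+2) w = 0. The minimum
   keeps the exponent at most N, as the induction requires. *)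
have kw1 : dker (minn l.+2 N) w.
  have [le_l|lt_l] := leqP l.+2 N; last first.
    by apply: dpow_nilp; lia.
  have kz' : dpow (i + l.+1%:Z) (z - comb a - dpow i w) = 0.
    by apply: dpow_ker kw _ _ => /=; lia.
  move: kz'; rewrite !linearB /= kz dpow_comb_out /=; last by lia.
  rewrite dpow_comp; [|lia..]; rewrite subr0 sub0r => /eqP; rewrite oppr_eq0 => /eqP.
  by rewrite /dker (_ : i - 1 + l.+2%:Z = i + l.+1%:Z) //; lia.
(* Since [w] lies one degree lower, its distance to [j] is b + 1; b < N makes the truncated
   difference N - b drop. *)
have [|||x3 Ex3] := IHr _ b.+1 (i - 1) w _ _ _ kw1; [lia..|].
exists (x1 + x2 + x3); rewrite !linearD /= Ex1 Ex2 Ex3 !linearB /=.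
by rewrite (@dpow_comp _ _ _ (i - 1) i j); [rewrite -addrA subrK addrC subrK | lia..].
Qed.

Lemma assemble_surj j (z : M j) : exists x, assemble x = z.
Proof.
have [|||x Ex] := @assemble_dpow_ker N 0 j j z; rewrite ?addr0 //.
  exact: dpow_nilp.
by exists x; rewrite Ex dpow_id.
Qed.

(** Put e = l - m and apply d^e to [assemble x]. Strands with l' - m' < e die; those with l' - m' >
    e, or with equality and m' < m, vanish by induction. The remaining ones with m' > m start
    earlier, so the (m, l) combination lies in ker d^l + im d and its coefficients are 0. *)
Lemma assemble_inj_coord j (x : std k n j) : assemble x = 0 ->
  forall (m l : 'I_N) (t : 'I_(n (j - (m : nat)%:Z) l)),
  std_coord (p := (j - (m : nat)%:Z, l)) t x = 0.
Proof.
move=> x0 m l; have [lt_lm t|le_ml] := ltnP l m.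
  by apply: std_coord_out => /=; lia.
(* Since m < N, this measure is lexicographic: larger l - m first, then smaller m. *)
have [r] := ubnP ((N - (l - m)) * N + m)%N.
elim: r m l le_ml => // r IHr m l le_ml lt_r.
pose s (m' l' : 'I_N) : M (j - (m' : nat)%:Z) :=
  comb (i := j - (m' : nat)%:Z) (l := l')
    (fun t => std_coord (p := (j - (m' : nat)%:Z, l')) t x).
set e := (l - m)%N in lt_r.
have s_out (m' l' : 'I_N) : (l' < m' + e)%N -> dpow (j + e%:Z) (s m' l') = 0.
  by move=> lt_l'; apply: dpow_comb_out; lia.
have s_IH (m' l' : 'I_N) : (m' + e <= l')%N -> (m' < m)%N || (m' + e < l')%N -> s m' l' = 0.
  move=> le_l' lt_or; apply: comb0; apply: IHr; first by lia.
  rewrite ltnS in lt_r; apply: leq_trans lt_r.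
  have [lt_l'|le_l'2] := ltnP (m' + e) l'; last first.
    have -> : (l' - m' = e)%N by lia.
    by rewrite ltn_add2l; move: lt_or; rewrite [(_ < l')%N]ltnNge le_l'2 orbF.
  have : ((N - (l' - m')).+1 * N <= (N - e) * N)%N
    by rewrite leq_mul2r; have := ltn_ord l'; lia.
  rewrite mulSnr; have := ltn_ord m'; lia.
apply: (gen_v (j - (m : nat)%:Z) l).1.2.
(* The sign comes from [assemble x = 0]. For m' < m the target degree lies below the start and
   [dpow] is 0 by convention, which agrees with [s_out] and [s_IH]. *)
exists (- \sum_(m' < N | m' != m) \sum_l' dpow (j - (m : nat)%:Z - 1) (s m' l')).
have Ej : j - (m : nat)%:Z + (l : nat)%:Z = j + e%:Z by lia.
rewrite /dker Ej linearN opprK linearD /=.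
have := congr1 (dpow (j + e%:Z)) x0.
rewrite linear0 /assemble (bigD1 m) //= linearD /= => <-; symmetry; congr (_ + _).
  rewrite linear_sum (bigD1 l) //= [X in _ + X = _]big1 ?addr0.
    by rewrite /strand dpow_comp //; lia.
  move=> l' ne_l'; rewrite /strand dpow_comp; [|lia..].
  have [|le_l'] := ltnP l' (m + e); first exact: s_out.
  rewrite [comb _]s_IH ?linear0 //.
  have : (l' : nat) != l by []; lia.
rewrite !linear_sum; apply: eq_bigr => m' ne_m'.
rewrite !linear_sum /=; apply: eq_bigr => l' _.
rewrite /strand [LHS]dpow_comp; [|lia..]; rewrite [RHS]dpow_comp; [|lia..].
have [lt_m'|le_m'] := ltnP m' m; last first.
  have ne_nat : (m' : nat) != m by [].
  by rewrite [RHS]dpow_comp //; lia.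
rewrite (@dpow_gt _ _ _ _ (_ - 1)) ?linear0; last by lia.
have [/s_out //|le_l'] := ltnP l' (m' + e).
by rewrite [comb _]s_IH ?linear0 ?lt_m'.
Qed.

Lemma assemble_inj0 j (x : std k n j) : assemble x = 0 -> x = 0.
Proof.
move=> x0; apply: std_coord_inj => -[i l] /= t; rewrite linear0.
have [in_ij|out] := boolP (i <= j <= i + (l : nat)%:Z); last exact: std_coord_out.
have lt_m : (`|j - i|%N < N)%N by have := ltn_ord l; lia.
have Ei : i = j - (Ordinal lt_m : nat)%:Z by move=> /=; lia.
move: (Ordinal lt_m) Ei => m Ei; subst i; exact: assemble_inj_coord.
Qed.

Lemma nc_iso_std : nc_iso M (std k n).
Proof.
apply/nc_iso_sym/(@nc_iso_bij _ _ _ _ assemble_hom).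
  exact: assemble_inj0.
exact: assemble_surj.
Qed.

End Decomposition.

(** * Existence and uniqueness of the multiplicities *)

Theorem proposition2p2 (k : fieldType) (N : nat) (hN : (0 < N)%N)
    (M : ncomplex k N) (hM : forall i : int, finite_dimensional (M i)) :
  exists! n : int -> 'I_N -> nat,
    nc_iso M (nc_dsum (fun p : int * 'I_N =>
      nc_copies (n p.1 p.2) (interval_complex k p.1 p.2))).
Proof.
(* Generators are chosen for every (i, l); their number is the multiplicity. *)
have gen i (l : 'I_N) := cid (generators_exist l (hM i)).
pose n i l := projT1 (gen i l).
have gen_v i l := svalP (cid (projT2 (gen i l))).
exists n; split; first exact: nc_iso_std gen_v.
move=> n' iso_n'; apply: functional_extensionality_dep => i.
apply: functional_extensionality_dep => l.
exact: nc_iso_std_size (gen_v i l) iso_n'.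
Qed.
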